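(* Let $G$ be a graph with vertex set $V$, and let $\mathcal{G}$ be the family of minimal generating sets of $G$. If $\mathcal{G}=\{L\}$ for a single set $L\subseteq V$, then $\operatorname{nim}(\mathrm{TER}(G))=1+\operatorname{pty}(L^c)$, where $L^c=V\setminus L$.
   Context: Graphs are finite and simple with nonempty vertex set. A set $K\subseteq V$ of vertices is convex if it contains every vertex lying on any shortest path between two elements of $K$. The convex hull $[P]$ of $P\subseteq V$ is the smallest convex set containing $P$. A set $P\subseteq V$ is generating if $[P]=V$; a minimal generating set is a generating set that is minimal under inclusion. For a finite set $A$, $\operatorname{pty}(A):=|A| \bmod 2\in\{0,1\}$. The game $\mathrm{TER}(G)$ (terminate): positions are the sets $P\subseteq V$ of jointly selected vertices reachable from the starting position $\emptyset$ by the following moves. If $[V\setminus P]=V$, then the options of $P$ are all sets $P\cup\{v\}$ with $v\in V\setminus P$; if $[V\setminus P]\neq V$, then $P$ is terminal (has no options). The nim-value of a position is defined recursively by $\operatorname{nim}(p)=\operatorname{mex}\{\operatorname{nim}(q): q\text{ an option of }p\}$, where $\operatorname{mex}(A)$ is the smallest nonnegative integer not in $A$; the nim-value of a game is that of its starting position. *)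

(* Defs.v *)
From HB Require Import structures.
From mathcomp Require Import all_boot.
From mathcomp Require Import boolp.

Set Implicit Arguments.
Unset Strict Implicit.
Unset Printing Implicit Defensive.

(** * Geodesic convexity *)

(* A simple graph on V is a symmetric irreflexive e : rel V. The path
   x = x_0, x_1, ..., x_n is encoded by x and p = [:: x_1; ...; x_n], so that
   its length is size p. MathComp's [path] allows repeated vertices. *)
Definition is_path (V : finType) (e : rel V) (x y : V) (p : seq V) : bool :=
  [&& path e x p, uniq (x :: p) & last x p == y].

Definition shortest_path (V : finType) (e : rel V) (x y : V) (p : seq V) :
    Prop :=
  is_path e x y p /\ forall q : seq V, is_path e x y q -> size p <= size q.

Definition convex (V : finType) (e : rel V) (K : {set V}) : Prop :=
  forall (x y : V) (p : seq V), x \in K -> y \in K ->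
  shortest_path e x y p -> {subset x :: p <= K}.

Definition hull (V : finType) (e : rel V) (P : {set V}) : {set V} :=
  \bigcap_(K : {set V} | `[< convex e K >] && (P \subset K)) K.

Lemma hull_convex (V : finType) (e : rel V) (P : {set V}) :
  convex e (hull e P).
Proof.
move=> x y p /bigcapP xK /bigcapP yK sp z zp; apply/bigcapP => K hK.
case/andP: (hK) => /asboolP cK _.
exact: (cK x y p (xK K hK) (yK K hK) sp z zp).
Qed.

Lemma sub_hull (V : finType) (e : rel V) (P : {set V}) : P \subset hull e P.
Proof. by apply/bigcapsP => K /andP[]. Qed.

Lemma hull_min (V : finType) (e : rel V) (P K : {set V}) :
  convex e K -> P \subset K -> hull e P \subset K.
Proof. by move=> cK PK; apply: bigcap_inf; rewrite PK andbT; apply/asboolP. Qed.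

Definition generating (V : finType) (e : rel V) : pred {set V} :=
  fun P => hull e P == [set: V].

Definition minimal_generating_sets (V : finType) (e : rel V) :
    {set {set V}} :=
  [set P | minset (generating e) P].

Definition pty (V : finType) (A : {set V}) : nat := #|A| %% 2.

(** * Impartial games *)

Lemma mex_subproof (s : seq nat) : exists n, n \notin s.
Proof.
exists (\max_(i <- s) i).+1; apply/negP => /(@leq_bigmax_seq _ _ xpredT id).
by move=> /(_ isT); rewrite ltnn.
Qed.

Definition mex (s : seq nat) : nat := ex_minn (mex_subproof s).

Record game := Game {
  position : finType;
  start : position;
  options : position -> {set position};
  options_wf : well_founded (fun q p => q \in options p)
}.

Definition nim_pos (g : game) : position g -> nat :=
  Fix (@options_wf g) (fun _ => nat)
    (fun p rec => mex [seq rec (val q) (valP q) | q : {q | q \in options p}]).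

Lemma nim_posE (g : game) (p : position g) :
  nim_pos p = mex [seq nim_pos q | q in options p].
Proof.
rewrite /nim_pos Fix_eq; last first.
  by move=> x f h fh; congr mex; apply: eq_map => q; exact: fh.
rewrite /mex; case: ex_minnP => m mP mmin; case: ex_minnP => n nP nmin.
rewrite -[Fix _ _ _]/(@nim_pos g) in mP mmin nP nmin.
have E : [seq nim_pos (val q) | q : {q | q \in options p}]
           =i [seq nim_pos q | q in options p].
  move=> k; apply/imageP/imageP => [[q _ ->]|[q qp ->]].
    by exists (val q) => //; exact: valP.
  by exists (exist _ q qp).
apply/eqP; rewrite eqn_leq; apply/andP; split.
- by apply: mmin; rewrite E.
- by apply: nmin; rewrite -E.
Qed.

Definition nim (g : game) : nat := nim_pos (start g).

(** * The terminate game *)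

Definition ter_move (V : finType) (e : rel V) : rel {set V} := fun P Q =>
  generating e (~: P) && [exists v in ~: P, Q == v |: P].

(* The positions reachable from the empty set. *)
Definition ter_position (V : finType) (e : rel V) : finType :=
  {P : {set V} | connect (ter_move e) set0 P}.

Definition ter_start (V : finType) (e : rel V) : ter_position e :=
  exist _ set0 (connect0 (ter_move e) set0).

Definition ter_options (V : finType) (e : rel V) (P : ter_position e) :
    {set ter_position e} :=
  [set Q : ter_position e | ter_move e (val P) (val Q)].

Lemma ter_move_card (V : finType) (e : rel V) (P Q : {set V}) :
  ter_move e P Q -> #|~: Q| < #|~: P|.
Proof.
move=> /andP[_ /exists_inP[v vP /eqP ->]]; apply: proper_card.
apply/properP; split; first by rewrite setCS subsetUr.
by exists v => //; rewrite in_setC in_setU1 eqxx.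
Qed.

Lemma ter_wf (V : finType) (e : rel V) :
  well_founded (fun Q P : ter_position e => Q \in ter_options P).
Proof.
suff H n (P : ter_position e) : #|~: val P| < n ->
    Acc (fun Q P : ter_position e => Q \in ter_options P) P.
  by move=> P; apply: H (ltnSn _).
elim: n P => [|n IHn] P leP; first by rewrite ltn0 in leP.
constructor=> Q; rewrite in_set => /ter_move_card ltQP.
by apply: IHn; apply: leq_trans ltQP _; rewrite -ltnS.
Qed.

Definition TER (V : finType) (e : rel V) : game :=
  @Game (ter_position e) (ter_start e) (@ter_options V e) (@ter_wf V e).

(* Main.v *)
(* Every generating set contains a minimal one, hence the generating sets are
   exactly the supersets of L, and a position P is terminal iff it meets L. As
   V is nonempty, so is L: from a nonterminal P the players can always move to
   a terminal position, of nim-value 0, by choosing a vertex of L. The other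
   moves choose one of the remaining vertices of ~: L, so that the nim-values of
   nonterminal positions alternate between 1 (no such vertex left) and 2. *)

Require Import Defs.
From mathcomp Require Import all_boot.

Lemma mexP (s : seq nat) (n : nat) :
  n \notin s -> (forall m, m < n -> m \in s) -> mex s = n.
Proof.
move=> ns lts; rewrite /mex; case: ex_minnP => m ms m_min.
apply/eqP; rewrite eqn_leq m_min //= leqNgt.
by apply: contra ms; apply: lts.
Qed.

Lemma hullS (V : finType) (e : rel V) (P Q : {set V}) :
  P \subset Q -> hull e P \subset hull e Q.
Proof.
move=> PQ; apply: hull_min; first exact: hull_convex.
exact: subset_trans PQ (sub_hull e Q).
Qed.

Lemma generatingS (V : finType) (e : rel V) (P Q : {set V}) :
  P \subset Q -> generating e P -> generating e Q.
Proof.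
by move=> PQ /eqP genP; rewrite /generating -subTset -genP hullS.
Qed.

Lemma hull0 (V : finType) (e : rel V) : hull e set0 = set0.
Proof.
apply/eqP; rewrite -subset0; apply: hull_min => // x y p.
by rewrite inE.
Qed.

Section UniqueMinimalGeneratingSet.

Context (V : finType) (e : rel V) (L : {set V}).
Context (unique_L : minimal_generating_sets e = [set L]).

Lemma minset_unique_generating : minset (generating e) L.
Proof.
by have := set11 L; rewrite -unique_L inE.
Qed.

Lemma generating_unique (P : {set V}) : generating e P = (L \subset P).
Proof.
apply/idP/idP => [genP | LP].
  have [M minM MP] := minset_exists genP.
  suff /set1P <- : M \in [set L] by [].
  by rewrite -unique_L inE.
by apply: generatingS LP _; exact: minsetp minset_unique_generating.
Qed.

(** The empty set is convex, hence its own hull, so it cannot generate a nonempty [V]. *)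
Lemma unique_generating_neq0 : 0 < #|V| -> L != set0.
Proof.
move=> V_gt0; apply/eqP => L0.
have := minsetp minset_unique_generating.
by rewrite /generating L0 hull0 eqEcard cardsT cards0 leqNgt V_gt0 andbF.
Qed.

Lemma ter_move_unique (P Q : {set V}) :
  ter_move e P Q = [disjoint L & P] && [exists v in ~: P, Q == v |: P].
Proof.
by rewrite /ter_move generating_unique disjoints_subset.
Qed.

(** Positions carry a proof of reachability, so an option is built by extending the path that leads
    to [P] by one move. *)
Lemma ter_option_exists (P : ter_position e) (v : V) :
    [disjoint L & val P] -> v \notin val P ->
  exists2 Q : ter_position e, Q \in ter_options P & val Q = v |: val P.
Proof.
move=> LP vP; have mvP : ter_move e (val P) (v |: val P).
  by rewrite ter_move_unique LP; apply/exists_inP; exists v; rewrite ?inE.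
have cQ := connect_trans (valP P) (connect1 mvP).
by exists (exist _ (v |: val P) cQ); rewrite ?inE.
Qed.

Lemma nim_ter_terminal (P : position (TER e)) :
  ~~ [disjoint L & val P] -> nim_pos P = 0.
Proof.
move=> LP; rewrite nim_posE; apply: mexP => //.
by apply/imageP => -[Q]; rewrite inE ter_move_unique (negPf LP).
Qed.

(** Strong induction on the number of vertices outside both [L] and [P]: a move outside [L] lowers
    it by one and so flips its parity. *)
Lemma nim_ter_nonterminal (P : position (TER e)) :
  L != set0 -> [disjoint L & val P] -> nim_pos P = 1 + pty (~: (L :|: val P)).
Proof.
move=> /set0Pn[l lL]; have [n] := ubnP #|~: (L :|: val P)|.
elim: n P => // n IHn P; rewrite ltnS => le_n LP.
have lP : l \notin val P by rewrite (disjointFr LP lL).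
have val_next v (Q : position (TER e)) : v \notin L -> v \notin val P ->
    val Q = v |: val P ->
    nim_pos Q = 1 + pty (~: (L :|: val Q)) /\
    #|~: (L :|: val P)| = #|~: (L :|: val Q)|.+1.
  move=> vL vP defQ.
  have cardE : #|~: (L :|: val P)| = #|~: (L :|: val Q)|.+1.
    rewrite (cardsD1 v) !inE (negPf vL) (negPf vP) /= add1n defQ.
    congr (#|pred_of_set _|.+1); apply/setP => x; rewrite !inE.
    by case: (x == v); rewrite ?orbT.
  split=> //; apply: IHn; first by rewrite -cardE.
  by rewrite defQ disjoints_subset setCU subsetI -!disjoints_subset LP
    disjoint_sym disjoints1 vL.
rewrite nim_posE; apply: mexP => [|m].
  apply/imageP => -[Q]; rewrite inE ter_move_unique => /andP[_].
  move=> /exists_inP[v]; rewrite inE => vP /eqP defQ.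
  (* A move in [L] yields value 0, while the claimed value is positive; any other move yields the
     value of opposite parity. *)
  have [vL | vL] := boolP (v \in L).
    rewrite nim_ter_terminal // -setI_eq0; apply/set0Pn; exists v.
    by rewrite inE vL defQ setU11.
  have [-> cardE] := val_next v Q vL vP defQ.
  rewrite /pty cardE !modn2 /= => /addnI.
  by case: odd.
(* Value 0 is reached by selecting [l], which ends the game. *)
case: m => [_ | m].
  have [Q PQ defQ] := ter_option_exists P l LP lP.
  apply/imageP; exists Q => //; rewrite nim_ter_terminal // -setI_eq0.
  by apply/set0Pn; exists l; rewrite inE lL defQ setU11.
(* The only other smaller value is 1, below a claimed value of 2. The count of vertices outside [L]
   and [P] is then odd, hence positive, and selecting one of them makes it even. *)
rewrite /pty modn2 ltnS.
case: (boolP (odd _)) => //= odd_k; rewrite ltnS leqn0 => /eqP->.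
have /card_gt0P[v] : 0 < #|~: (L :|: val P)| by case: #|_| odd_k.
rewrite !inE negb_or => /andP[vL vP].
have [Q PQ defQ] := ter_option_exists P v LP vP.
apply/imageP; exists Q => //.
have [-> cardE] := val_next v Q vL vP defQ.
by move: odd_k; rewrite /pty cardE /= modn2 => /negPf->.
Qed.

End UniqueMinimalGeneratingSet.

Theorem proposition4p5 (V : finType) (e : rel V) (e_sym : symmetric e)
    (e_irr : irreflexive e) (V_nonempty : 0 < #|V|) (L : {set V})
    (unique_L : minimal_generating_sets e = [set L]) :
  nim (TER e) = 1 + pty (~: L).
Proof.
have L_neq0 := unique_generating_neq0 _ _ _ unique_L V_nonempty.
rewrite /nim (nim_ter_nonterminal _ _ _ unique_L) //= ?setU0 //.
by rewrite -setI_eq0 setI0.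
Qed.
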